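(* For any $L \in \left[0,1/\sqrt[3]{3}\right]$ and $\epsilon>0$, there exists a periodic set $I \subseteq \mathbb{N}$ such that the growth rate $\lim_{n \to \infty} \left(p_n(I)/n!\right)^{1/n}$ exists and satisfies \[ \left|\lim_{n \to \infty} \left(\frac{p_n(I)}{n!}\right)^{1/n} - L\right|<\epsilon. \]
   Context: For $I \subseteq \mathbb{N}$, $p_n(I)$ denotes the number of permutations $\pi \in \mathfrak{S}_n$ whose peak set is exactly $I \cap [n-1]$, i.e. $\pi_{i-1} < \pi_i > \pi_{i+1}$ if and only if $i \in I \cap [n-1]$ (by convention a permutation never has a peak at its first or last position). The growth rate of $\{p_n(I)\}$ is $\lim_{n \to \infty} \left(p_n(I)/n!\right)^{1/n}$. A set $I \subseteq \mathbb{N}$ is periodic if its indicator word $w \in \{0,1\}^{\omega}$ (with $w_i = 1$ iff $i \in I$) is of the form $x^\omega$ for a finite word $x$. The maximum possible growth rate over all $I$ is $1/\sqrt[3]{3}$. *)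

(* Defs.v *)
From HB Require Import structures.
From mathcomp Require Import all_boot all_order all_algebra perm.
From mathcomp Require Import all_classical all_reals all_analysis.
Import Order.TTheory GRing.Theory Num.Theory.
Import numFieldNormedType.Exports.

Set Implicit Arguments.
Unset Strict Implicit.
Unset Printing Implicit Defensive.

Local Open Scope classical_set_scope.
Local Open Scope ring_scope.

(* The one-line notation of s : 'S_n is pi_1 ... pi_n, where pi_i is the value
   of s at the ordinal i - 1.  Hence in [has_peak s i] the ordinals a, b, c
   carry pi_(i-1), pi_i, pi_(i+1); they only exist together if 1 < i < n. *)
Definition has_peak (n : nat) (s : 'S_n) (i : nat) : Prop :=
  exists a b c : 'I_n,
    [/\ a.+1 = i.-1, b.+1 = i, c.+1 = i.+1, (s a < s b)%N & (s c < s b)%N].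

Definition peak_set (n : nat) (s : 'S_n) : set nat := [set i | has_peak s i].

Definition peak_count (n : nat) (I : set nat) : nat :=
  #|[set s : 'S_n | `[< peak_set s = I `&` [set i | (1 <= i <= n.-1)%N] >]]%SET|.

Definition growth_seq (R : realType) (I : set nat) : R^nat :=
  fun n => ((peak_count n I)%:R / (n`!)%:R) `^ (n%:R)^-1.

(* The indicator word of a set of positive integers is w_1 w_2 w_3 ..., while
   the letters of x are indexed from 0. *)
Definition periodic_set (I : set nat) : Prop :=
  exists2 x : seq bool, x <> [::] &
    forall i : nat, (i.+1 \in I) = nth false x (i %% size x).

(* Main.v *)
Require Import Defs.
From HB Require Import structures.
From mathcomp Require Import all_boot all_order all_algebra perm.
From mathcomp Require Import all_classical all_reals all_analysis.
From mathcomp Require Import zify ring lra.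
Import Order.TTheory GRing.Theory Num.Theory.
Import numFieldNormedType.Exports.
Local Open Scope classical_set_scope.
Local Open Scope ring_scope.

(** Let Q(w) be the proportion of permutations of length |w| whose interior
    peaks are at the letters 1 of the finite word w.  The relative orders of
    the first m and of the last n values of a random permutation of length
    m + n are independent, so Q(uv) <= Q(u) Q(v), with equality if u and v
    begin with 01 and end with 10, because then no peak can occur at the seam.
    Hence the periodic set with such a period x has growth rate
    Q(x)^(1/|x|).  The period 010 has rate at least 3^(-1/3), and the period
    01 0^(2h) 10 has positive rate at most (2/h!)^(1/(2h+4)), which tends to 0.
    Concatenating copies of these two words realizes a dense set of their
    weighted geometric means. *)

(** * Permutations as sequences, and predicates that see only relative order *)

Definition ext_ord (n : nat) (g : 'I_n -> nat) (i : nat) : nat :=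
  oapp g 0%N (insub i).

Lemma ext_ordE (n : nat) (g : 'I_n -> nat) (i : nat) (lt_in : (i < n)%N) :
  ext_ord n g i = g (Ordinal lt_in).
Proof. by rewrite /ext_ord insubT. Qed.

(** Positions are plain naturals, so that a block can be shifted by m without casts. From n on the
    value is the default 0, which no order-invariant predicate of the first n values can detect. *)
Definition perm_val (n : nat) (s : 'S_n) : nat -> nat :=
  ext_ord n (fun i => val (s i)).

Lemma perm_valE (n : nat) (s : 'S_n) (i : 'I_n) : perm_val n s i = s i.
Proof. by rewrite /perm_val /ext_ord valK. Qed.

Definition order_invariant (n : nat) (P : pred (nat -> nat)) : Prop :=
  forall f g : nat -> nat,
    (forall i j, (i < n)%N -> (j < n)%N -> (f i < f j)%N = (g i < g j)%N) ->
    P f = P g.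

Definition perm_count (n : nat) (P : pred (nat -> nat)) : nat :=
  #|[set s : 'S_n | P (perm_val n s)]%SET|.

(** Each index is sent to its rank, the number of indices with a smaller value. *)
Lemma standardize (n : nat) (g : 'I_n -> nat) : injective g ->
  exists r : 'S_n, forall i j, (r i < r j)%N = (g i < g j)%N.
Proof.
move=> g_inj.
pose rk i := #|[set k : 'I_n | (g k < g i)%N]%SET|.
have rk_lt i : (rk i < n)%N.
  rewrite -[X in (_ < X)%N]card_ord /rk -cardsT; apply: proper_card.
  apply/properP; split; first exact: finset.subsetT.
  by exists i; rewrite ?inE ?ltnn.
have rk_mono i j : (g i < g j)%N -> (rk i < rk j)%N.
  move=> ltij; apply: proper_card; apply/properP; split.
    by apply/fintype.subsetP => k; rewrite !inE => /ltn_trans; apply.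
  by exists i; rewrite !inE ?ltnn.
have rkE i j : (rk i < rk j)%N = (g i < g j)%N.
  apply/idP/idP; last exact: rk_mono.
  case: (ltngtP (g i) (g j)) => // [/rk_mono|/g_inj ->]; last by rewrite ltnn.
  by move=> h1 h2; move: (ltn_trans h1 h2); rewrite ltnn.
have r_inj : injective (fun i => Ordinal (rk_lt i)).
  move=> i j /(congr1 val) /= eqr; apply: g_inj.
  by case: (ltngtP (g i) (g j)) => //; rewrite -rkE eqr ltnn.
by exists (perm r_inj) => i j; rewrite !permE /= rkE.
Qed.

(** If r standardizes g, then g after s is ordered like [s * r], and right multiplication by r is a
    bijection of the symmetric group. *)
Lemma card_relabel (n : nat) (P : pred (nat -> nat)) (g : 'I_n -> nat) :
  order_invariant n P -> injective g ->
  #|[set s : 'S_n | P (ext_ord n (fun i => g (s i)))]%SET| = perm_count n P.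
Proof.
move=> Pinv /standardize[r rE].
rewrite /perm_count -[RHS](card_preimset _ (@mulIg _ r)); apply: eq_card => s.
rewrite !inE; apply: Pinv => i j lti ltj.
by rewrite /perm_val !ext_ordE !permM rE.
Qed.

Section BlockPerm.
Variables (m n : nat) (s : 'S_m) (t : 'S_n).

(** Embeds pairs of permutations as the Young subgroup that preserves the first m and the last n
    positions. *)
Definition block_perm_fun (x : 'I_(m + n)) : 'I_(m + n) :=
  unsplit (match fintype.split x with inl i => inl (s i) | inr j => inr (t j) end).

Lemma block_perm_inj : injective block_perm_fun.
Proof.
move=> x y /(can_inj (@unsplitK _ _)); rewrite -[x]splitK -[y]splitK !unsplitK.
case: (fintype.split x) => i; case: (fintype.split y) => j //= [] /perm_inj -> //.
Qed.

Definition block_perm : 'S_(m + n) := perm block_perm_inj.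

Lemma block_perml (i : 'I_m) : block_perm (lshift n i) = lshift n (s i).
Proof. by rewrite permE /block_perm_fun -[lshift n i]/(unsplit (inl i)) unsplitK. Qed.

Lemma block_permr (i : 'I_n) : block_perm (rshift m i) = rshift m (t i).
Proof. by rewrite permE /block_perm_fun -[rshift m i]/(unsplit (inr i)) unsplitK. Qed.
End BlockPerm.

(* Double counting of the pairs formed by s and an element b of the Young
   subgroup S_m x S_n such that b * s is counted on the left. *)
Lemma perm_count_cat (m n : nat) (P P' : pred (nat -> nat)) :
  order_invariant m P -> order_invariant n P' ->
  (perm_count (m + n) (fun f => P f && P' (fun i => f (m + i)%N)) * (m`! * n`!) =
   (m + n)`! * (perm_count m P * perm_count n P'))%N.
Proof.
move=> Pinv Pinv'.
pose PP f := P f && P' (fun i => f (m + i)%N).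
(* For fixed b, the map sending s to [b * s] is a bijection, so every b contributes the full
   count. *)
have bij_count (b : 'S_(m + n)) :
    (\sum_(s : 'S_(m + n)) PP (perm_val _ (b * s)%g) = perm_count (m + n) PP)%N.
  rewrite /perm_count -sum1_card [RHS]big_mkcond /=
    [RHS](reindex_inj (mulgI b)) /=.
  apply: eq_bigr => s _; rewrite inE; by case: (PP _).
(* For fixed s, the block permutation rearranges the values [gl] and [gr] of the two blocks
   separately; relabelling by rank turns this into two independent counts. *)
have fibre_count (s : 'S_(m + n)) :
    (\sum_(st : 'S_m * 'S_n) PP (perm_val _ (block_perm m n st.1 st.2 * s)%g) =
     perm_count m P * perm_count n P')%N.
  pose gl i : nat := s (lshift n i); pose gr i : nat := s (rshift m i).
  have gl_inj : injective gl by move=> i j /val_inj /perm_inj /lshift_inj.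
  have gr_inj : injective gr by move=> i j /val_inj /perm_inj /rshift_inj.
  rewrite -(card_relabel _ _ gl Pinv gl_inj) -(card_relabel _ _ gr Pinv' gr_inj).
  rewrite -cardsX -sum1_card [RHS]big_mkcond /=; apply: eq_bigr => -[a b] _ /=.
  rewrite !inE /= /PP.
  have -> : P (perm_val _ (block_perm m n a b * s)%g) = P (ext_ord m (fun i => gl (a i))).
    apply: Pinv => i j lti ltj; rewrite /perm_val.
    have hi := ltn_addr n lti; have hj := ltn_addr n ltj.
    rewrite !ext_ordE.
    rewrite (_ : Ordinal hi = lshift n (Ordinal lti)); last exact: val_inj.
    rewrite (_ : Ordinal hj = lshift n (Ordinal ltj)); last exact: val_inj.
    by rewrite !permM !block_perml.
  have -> : P' (fun i => perm_val _ (block_perm m n a b * s)%g (m + i)%N) =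
            P' (ext_ord n (fun i => gr (b i))).
    apply: Pinv' => i j lti ltj; rewrite /perm_val.
    have hi : (m + i < m + n)%N by rewrite ltn_add2l.
    have hj : (m + j < m + n)%N by rewrite ltn_add2l.
    rewrite !ext_ordE.
    rewrite (_ : Ordinal hi = rshift m (Ordinal lti)); last exact: val_inj.
    rewrite (_ : Ordinal hj = rshift m (Ordinal ltj)); last exact: val_inj.
    by rewrite !permM !block_permr.
  by case: (P _); case: (P' _).
have swap : (\sum_(s : 'S_(m + n)) \sum_(st : 'S_m * 'S_n)
       PP (perm_val _ (block_perm m n st.1 st.2 * s)%g) =
     \sum_(st : 'S_m * 'S_n) \sum_(s : 'S_(m + n))
       PP (perm_val _ (block_perm m n st.1 st.2 * s)%g))%N.
  exact: exchange_big.
move: swap; rewrite (eq_bigr _ (fun s _ => fibre_count s)).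
rewrite [X in _ = X -> _](eq_bigr _ (fun st _ => bij_count (block_perm m n st.1 st.2))).
rewrite !sum_nat_const card_prod !card_Sn => ->.
by rewrite mulnC.
Qed.

(** * Probabilities of order events for a random permutation *)

Definition perm_prob (R : realType) (n : nat) (P : pred (nat -> nat)) : R :=
  (perm_count n P)%:R / (n`!)%:R.

Section PermProb.
Variable R : realType.

Lemma factR_gt0 (n : nat) : 0 < (n`!)%:R :> R.
Proof. by rewrite ltr0n fact_gt0. Qed.

Lemma factR_neq0 (n : nat) : (n`!)%:R != 0 :> R.
Proof. by rewrite gt_eqF ?factR_gt0. Qed.

Lemma perm_prob_ge0 (n : nat) (P : pred (nat -> nat)) : 0 <= perm_prob R n P.
Proof. by rewrite /perm_prob divr_ge0 ?ler0n. Qed.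

Lemma perm_prob_predT (n : nat) : perm_prob R n predT = 1.
Proof.
rewrite /perm_prob /perm_count (_ : [set s | _]%SET = [set: 'S_n]%SET).
  by rewrite cardsT card_Sn divff ?factR_neq0.
by apply/setP => s; rewrite !inE.
Qed.

Lemma perm_val_inj (n : nat) (s : 'S_n) (i j : nat) : (i < n)%N -> (j < n)%N ->
  perm_val n s i = perm_val n s j -> i = j.
Proof.
by move=> lti ltj; rewrite /perm_val !ext_ordE => /val_inj /perm_inj [].
Qed.

(** Only injective sequences need comparing, which lets later arguments exclude ties. *)
Lemma le_perm_prob (n : nat) (P P' : pred (nat -> nat)) :
  (forall f, (forall i j, (i < n)%N -> (j < n)%N -> f i = f j -> i = j) ->
     P f -> P' f) ->
  perm_prob R n P <= perm_prob R n P'.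
Proof.
move=> sPP'; rewrite /perm_prob ler_pM2r ?invr_gt0 ?factR_gt0 // ler_nat.
apply/subset_leq_card/fintype.subsetP => s; rewrite !inE; apply: sPP'.
exact: perm_val_inj.
Qed.

Lemma perm_prob_le1 (n : nat) (P : pred (nat -> nat)) : perm_prob R n P <= 1.
Proof. by rewrite -(perm_prob_predT n); apply: le_perm_prob. Qed.

Lemma perm_probU (n : nat) (P P' : pred (nat -> nat)) :
  perm_prob R n (predU P P') <= perm_prob R n P + perm_prob R n P'.
Proof.
rewrite /perm_prob -mulrDl ler_pM2r ?invr_gt0 ?factR_gt0 // -natrD ler_nat.
rewrite /perm_count (_ : [set s | _]%SET =
  ([set s : 'S_n | P (perm_val n s)] :|: [set s : 'S_n | P' (perm_val n s)])%SET).
  by rewrite cardsU leq_subr.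
by apply/setP => s; rewrite !inE.
Qed.

Lemma perm_prob_cat (m n : nat) (P P' : pred (nat -> nat)) :
  order_invariant m P -> order_invariant n P' ->
  perm_prob R (m + n) (fun f => P f && P' (fun i => f (m + i)%N)) =
  perm_prob R m P * perm_prob R n P'.
Proof.
move=> Pinv Pinv'; have := perm_count_cat m n P P' Pinv Pinv'.
move/(congr1 (fun k => k%:R : R)); rewrite !natrM /perm_prob => eqc.
have m0 := factR_neq0 m; have n0 := factR_neq0 n; have mn0 := factR_neq0 (m + n).
apply: (mulIf mn0); rewrite divfK //; apply: (mulIf (mulf_neq0 m0 n0)).
by rewrite eqc; field; rewrite m0 n0.
Qed.

(** The standardization of f is a permutation that is counted, so an explicit sequence with distinct
    values is enough of a witness. *)
Lemma perm_prob_gt0 (n : nat) (P : pred (nat -> nat)) (f : nat -> nat) :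
  order_invariant n P ->
  (forall i j, (i < n)%N -> (j < n)%N -> f i = f j -> i = j) -> P f ->
  0 < perm_prob R n P.
Proof.
move=> Pinv f_inj Pf; rewrite /perm_prob divr_gt0 ?factR_gt0 // ltr0n.
have /standardize[r rE] : injective (fun i : 'I_n => f i).
  by move=> i j /f_inj eqij; apply: val_inj; apply: eqij.
apply/card_gt0P; exists r; rewrite inE (Pinv _ f) // => i j lti ltj.
by rewrite /perm_val !ext_ordE rE.
Qed.

End PermProb.

(** * Monotone sequences *)

Lemma perm_order_inj (n : nat) (s t : 'S_n) :
  (forall i j, (s i < s j)%N = (t i < t j)%N) -> s = t.
Proof.
(* The value of a permutation at i is its rank among all values, which depends on the relative order
   alone. *)
have rank (u : 'S_n) i : val (u i) = #|[set j | (u j < u i)%N]%SET|.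
  rewrite (_ : [set j | _]%SET = (u @^-1: [set k : 'I_n | (k < u i)%N])%SET); last first.
    by apply/setP => j; rewrite !inE.
  rewrite card_preimset; last exact: perm_inj.
  have w_inj : injective (widen_ord (ltnW (ltn_ord (u i)))).
    by move=> a b /(congr1 val) /= /val_inj.
  rewrite -[LHS]card_ord -(card_imset _ w_inj).
  apply: eq_card => k; rewrite inE; apply/imsetP/idP => [[l _ ->] //=|ltk].
  by exists (Ordinal ltk) => //; apply: val_inj.
move=> eqst; apply/permP => i; apply: val_inj; rewrite (rank s i) (rank t i).
by apply: eq_card => j; rewrite !inE eqst.
Qed.

Lemma perm_count_sorted_le1 (n : nat) (up : bool) :
  (perm_count n (fun f => sorted (if up then ltn else gtn) (mkseq f n)) <= 1)%N.
Proof.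
have key (s : 'S_n) : sorted (if up then ltn else gtn) (mkseq (perm_val n s) n) ->
    forall i j, (s i < s j)%N = (if up then (i < j)%N else (j < i)%N).
  move=> srt.
  have step (i j : 'I_n) : (i < j)%N -> (if up then ltn else gtn) (s i) (s j).
    move=> ltij; have tr : transitive (if up then ltn else gtn).
      by case: up {srt} => a b c /=; lia.
    have := sorted_ltn_nth tr 0%N srt i j.
    rewrite !inE size_mkseq !ltn_ord => /(_ isT isT ltij).
    by rewrite !nth_mkseq // !perm_valE.
  move=> i j; case: (ltngtP i j) => [/step|/step|/val_inj ->]; last first.
  - by rewrite !ltnn if_same.
  - by case: (up) => /=; lia.
  - by case: (up) => /=; lia.
rewrite /perm_count; apply/card_le1_eqP => s t; rewrite !inE => /key ks /key kt.
by apply: perm_order_inj => i j; rewrite ks kt.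
Qed.

Lemma sorted_order_invariant (n : nat) (up : bool) :
  order_invariant n (fun f => sorted (if up then ltn else gtn) (mkseq f n)).
Proof.
move=> f g efg.
have aux f1 f2 : (forall i j, (i < n)%N -> (j < n)%N -> (f1 i < f1 j)%N = (f2 i < f2 j)%N) ->
    sorted (if up then ltn else gtn) (mkseq f1 n) ->
    sorted (if up then ltn else gtn) (mkseq f2 n).
  move=> e12 /(sortedP 0%N) srt; apply/(sortedP 0%N) => i; rewrite size_mkseq => lti.
  have := srt i; rewrite size_mkseq => /(_ lti); rewrite !nth_mkseq //; try lia.
  by case: (up) => /=; rewrite e12 //; lia.
by apply/idP/idP; apply: aux => // i j lti ltj; rewrite efg.
Qed.

(** * Peak patterns prescribed by words, and their concatenation *)

Definition is_peak (f : nat -> nat) (i : nat) : bool :=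
  (f i.-1 < f i)%N && (f i.+1 < f i)%N.

(* Only the interior letters of w constrain f. *)
Definition fits (w : seq bool) (f : nat -> nat) : bool :=
  all (fun i => is_peak f i == nth false w i) (iota 1 (size w - 2)).

Lemma fitsP (w : seq bool) (f : nat -> nat) :
  reflect (forall i, (0 < i)%N -> (i.+1 < size w)%N -> is_peak f i = nth false w i)
    (fits w f).
Proof.
apply: (iffP allP) => H i.
  by move=> i0 iw; apply/eqP/H; rewrite mem_iota; lia.
by rewrite mem_iota => /andP[i0 iw]; apply/eqP/H; lia.
Qed.

Lemma fits_order_invariant (w : seq bool) : order_invariant (size w) (fits w).
Proof.
move=> f g efg; apply/fitsP/fitsP => H i i0 iw; rewrite -H // /is_peak ?efg //; lia.
Qed.

Definition word_prob (R : realType) (w : seq bool) : R :=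
  perm_prob R (size w) (fits w).

(** Interior letters of either factor stay interior in the concatenation; splitting only drops the
    conditions at the seam. *)
Lemma fits_cat (u v : seq bool) (f : nat -> nat) :
  fits (u ++ v) f -> fits u f && fits v (fun i => f (size u + i)%N).
Proof.
move=> /fitsP H; rewrite size_cat in H; apply/andP; split; apply/fitsP => i i0 iw.
  rewrite H ?nth_cat //; last lia.
  by rewrite (_ : i < size u)%N //; lia.
have := H (size u + i)%N ltac:(lia) ltac:(lia).
rewrite nth_cat ltnNge leq_addr addKn /= => <-.
by case: i i0 {iw} => // i _; rewrite /is_peak !addnS.
Qed.

(* Sealed words can be concatenated without creating a peak at the seam: the
   letters 01 and 10 force the outer values of a block below their neighbours. *)
Definition sealed (w : seq bool) : bool :=
  (w == [::]) || [&& (2 < size w)%N, ~~ nth false w 0, nth false w 1,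
                    nth false w (size w - 2) & ~~ nth false w (size w - 1)].

Lemma sealed_cat (u v : seq bool) : sealed u -> sealed v -> sealed (u ++ v).
Proof.
case: (eqVneq u [::]) => [-> //|u0]; case: (eqVneq v [::]) => [->|v0].
  by rewrite cats0.
rewrite /sealed (negPf u0) (negPf v0) /=.
move=> /and5P[u1 u2 u3 u4 u5] /and5P[v1 v2 v3 v4 v5].
apply/orP; right; rewrite size_cat !nth_cat; apply/and5P; split.
- lia.
- by rewrite (_ : 0 < size u)%N //; lia.
- by rewrite (_ : 1 < size u)%N //; lia.
- rewrite (_ : (_ < size u)%N = false); last lia.
  by rewrite (_ : (_ - _ - _ = size v - 2)%N) //; lia.
- rewrite (_ : (_ < size u)%N = false); last lia.
  by rewrite (_ : (_ - _ - _ = size v - 1)%N) //; lia.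
Qed.

Lemma fits_sealed_cat (u v : seq bool) (f : nat -> nat) : sealed u -> sealed v ->
  fits (u ++ v) f = fits u f && fits v (fun i => f (size u + i)%N).
Proof.
move=> su sv; apply/idP/idP; first exact: fits_cat.
case: (eqVneq u [::]) su => [-> _|u0 /=]; first by case/andP.
case: (eqVneq v [::]) sv => [-> _|v0 /=]; first by rewrite cats0 => _ /andP[].
rewrite /sealed (negPf u0) (negPf v0) /=.
move=> /and5P[v1 v2 v3 v4 v5] /and5P[u1 u2 u3 u4 u5].
move=> /andP[/fitsP Hu /fitsP Hv]; apply/fitsP => i i0; rewrite size_cat nth_cat => iw.
have [lt1|ge1] := ltnP i.+1 (size u); first by rewrite Hu // (_ : i < size u)%N //; lia.
(* Last letter of u: the peak just before it forces a descent into it, so it is no peak whatever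
   follows. *)
have [eq1|ne1] := eqVneq i.+1 (size u).
  rewrite (_ : i < size u)%N; last lia.
  have /negPf -> : ~~ nth false u i by rewrite (_ : i = size u - 1)%N //; lia.
  have := Hu (size u - 2)%N; rewrite u4 /is_peak => h.
  have /andP[_] := h ltac:(lia) ltac:(lia).
  rewrite (_ : (size u - 2).+1 = i); last lia.
  rewrite (_ : (size u - 2) = i.-1)%N; last lia.
  by move=> h1; apply/negbTE; rewrite negb_and -leqNgt ltnW.
(* First letter of v: the peak just after it forces an ascent out of it. *)
have [eq2|ne2] := eqVneq i (size u).
  rewrite eq2 ltnn subnn (negPf v2).
  have := Hv 1%N isT ltac:(lia); rewrite v3 /is_peak /= => /andP[+ _].
  rewrite addn0 addn1 => h; apply/negbTE; rewrite negb_and orbC -leqNgt ltnW //.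
rewrite (_ : (i < size u)%N = false); last lia.
rewrite -Hv; try lia.
rewrite /is_peak (_ : (size u + (i - size u).-1 = i.-1)%N); last lia.
rewrite (_ : (size u + (i - size u).+1 = i.+1)%N); last lia.
by rewrite (_ : (size u + (i - size u) = i)%N) //; lia.
Qed.

(** * Word probabilities: submultiplicative, multiplicative on sealed words *)

Section WordProb.
Variable R : realType.

Lemma word_prob_ge0 (w : seq bool) : 0 <= word_prob R w.
Proof. exact: perm_prob_ge0. Qed.

Lemma word_prob_le1 (w : seq bool) : word_prob R w <= 1.
Proof. exact: perm_prob_le1. Qed.

Lemma word_prob_nil : word_prob R [::] = 1.
Proof. exact: perm_prob_predT. Qed.

Lemma word_prob_cat_le (u v : seq bool) :
  word_prob R (u ++ v) <= word_prob R u * word_prob R v.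
Proof.
rewrite -perm_prob_cat; [|exact: fits_order_invariant..].
by rewrite /word_prob size_cat; apply: le_perm_prob => f _; apply: fits_cat.
Qed.

Lemma word_prob_sealed_cat (u v : seq bool) : sealed u -> sealed v ->
  word_prob R (u ++ v) = word_prob R u * word_prob R v.
Proof.
move=> su sv; apply/eqP; rewrite eq_le word_prob_cat_le /=.
rewrite -perm_prob_cat; [|exact: fits_order_invariant..].
by rewrite /word_prob size_cat; apply: le_perm_prob => f _; rewrite fits_sealed_cat.
Qed.

Lemma word_prob_catl_le (u v : seq bool) : word_prob R (u ++ v) <= word_prob R u.
Proof.
apply: le_trans (word_prob_cat_le u v) _.
by rewrite ler_piMr ?word_prob_ge0 ?word_prob_le1.
Qed.

Lemma word_prob_catr_le (u v : seq bool) : word_prob R (u ++ v) <= word_prob R v.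
Proof.
apply: le_trans (word_prob_cat_le u v) _.
by rewrite ler_piMl ?word_prob_ge0 ?word_prob_le1.
Qed.

Lemma sealed_flatten_nseq (n : nat) (w : seq bool) :
  sealed w -> sealed (flatten (nseq n w)).
Proof. by move=> sw; elim: n => //= n IHn; apply: sealed_cat. Qed.

Lemma word_prob_flatten_nseq (n : nat) (w : seq bool) : sealed w ->
  word_prob R (flatten (nseq n w)) = word_prob R w ^+ n.
Proof.
move=> sw; elim: n => [|n IHn] /=; first by rewrite word_prob_nil expr0.
by rewrite word_prob_sealed_cat ?sealed_flatten_nseq // IHn exprS.
Qed.

(* A sequence without interior peak decreases, then increases, so one of its
   two halves is monotone. *)
Lemma word_prob_nopeak (h : nat) :
  word_prob R (nseq (h + h) false) <= 2 / (h`!)%:R.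
Proof.
pose dec f := sorted gtn (mkseq f h); pose inc f := sorted ltn (mkseq f h).
have le1 (up : bool) :
    perm_prob R h (fun f => sorted (if up then ltn else gtn) (mkseq f h)) <= (h`!)%:R^-1.
  rewrite /perm_prob ler_piMl ?invr_ge0 ?ler0n // lern1.
  exact: perm_count_sorted_le1.
rewrite /word_prob size_nseq.
apply: (@le_trans _ _ (perm_prob R (h + h) (predU
   (fun f => dec f && predT (fun i => f (h + i)%N))
   (fun f => predT f && inc (fun i => f (h + i)%N))))); last first.
  apply: le_trans (perm_probU _ _ _ _) _.
  rewrite !perm_prob_cat ?perm_prob_predT ?mulr1 ?mul1r //; last first.
  - exact: (sorted_order_invariant h false).
  - exact: (sorted_order_invariant h true).
  rewrite mulr_natl mulr2n; apply: lerD; [exact: (le1 false)|exact: (le1 true)].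
apply: le_perm_prob => f f_inj /fitsP; rewrite size_nseq => nopk /=.
rewrite andbT; case: (boolP (dec f)) => //= ndec.
(* A first half that is not decreasing contains an ascent, since injectivity excludes ties. *)
have [i ltih asc] : exists2 i, (i.+1 < h)%N & (f i < f i.+1)%N.
  apply/not_exists2P => nasc; case/negP: ndec; apply/(sortedP 0%N) => i.
  rewrite size_mkseq => ltih; rewrite !nth_mkseq //; last lia.
  case: (nasc i) => [//|/negP]; rewrite -leqNgt leq_eqVlt => /orP[/eqP|//].
  by move=> /f_inj; lia.
(* Without a peak, an ascent can only be followed by another ascent, so the ascents run to the end
   and cover the second half. *)
have run k : (i + k.+1 < h + h)%N -> (f (i + k) < f (i + k.+1))%N.
  elim: k => [|k IHk] ltk; first by rewrite addn0 addn1.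
  have {}IHk := IHk ltac:(lia).
  have := nopk (i + k.+1)%N ltac:(lia) ltac:(lia).
  rewrite nth_nseq if_same /is_peak !addnS /= in IHk *; rewrite IHk /= => /negbT.
  by rewrite -leqNgt leq_eqVlt => /orP[/eqP /f_inj|//]; lia.
apply/(sortedP 0%N) => j; rewrite size_mkseq => ltjh; rewrite !nth_mkseq //; last lia.
have := run (h + j - i)%N ltac:(lia).
rewrite (_ : i + (h + j - i) = h + j)%N; last lia.
by rewrite (_ : i + (h + j - i).+1 = h + j.+1)%N; last lia.
Qed.

End WordProb.

(** * The two building blocks: a likely word and an unlikely one *)

Definition peak_word : seq bool := [:: false; true; false].

Definition valley_word (h : nat) : seq bool :=
  [:: false; true] ++ nseq (h + h) false ++ [:: true; false].

Lemma sealed_peak_word : sealed peak_word.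
Proof. by []. Qed.

Lemma size_valley_word (h : nat) : size (valley_word h) = (h + h + 4)%N.
Proof. by rewrite /valley_word !size_cat size_nseq /=; lia. Qed.

Lemma nth_valley_word (h i : nat) :
  nth false (valley_word h) i = (i == 1)%N || (i == h + h + 2)%N.
Proof.
rewrite /valley_word; case: i => [|[|i]] //=; first by lia.
rewrite nth_cat size_nseq nth_nseq if_same; case: ltnP => hi; first by lia.
have [->|ne] := eqVneq i (h + h)%N; first by rewrite subnn /=; lia.
have [->|ne'] := eqVneq i (h + h).+1; first by rewrite subSnn /=; lia.
by rewrite nth_default /=; lia.
Qed.

Lemma sealed_valley_word (h : nat) : sealed (valley_word h).
Proof.
by rewrite /sealed !nth_valley_word size_valley_word; apply/orP; right; lia.
Qed.

Section Words.
Variable R : realType.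

(** Dropping the two outer letters on each side leaves a peak-free word of length 2h. *)
Lemma word_prob_valley_le (h : nat) :
  word_prob R (valley_word h) <= 2 / (h`!)%:R.
Proof.
apply: le_trans (word_prob_nopeak R h).
by apply: le_trans (word_prob_catr_le _ _ _) (word_prob_catl_le _ _ _).
Qed.

Lemma word_prob_valley_gt0 (h : nat) : (0 < h)%N -> 0 < word_prob R (valley_word h).
Proof.
move=> h0; rewrite /word_prob.
(* The sequence 0, 2h+4, 2, 3, ..., 2h+2, 1, with peaks exactly at indices 1 and 2h+2; for positive
   h these are not adjacent. *)
pose f i := if i == 0%N then 0%N else if i == 1%N then (h + h + 4)%N
            else if (i == h + h + 3)%N then 1%N else i.
apply: (@perm_prob_gt0 _ _ _ f); first exact: fits_order_invariant.
  by move=> i j; rewrite size_valley_word /f; do ![case: eqVneq => ? /=]; lia.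
apply/fitsP => i i0; rewrite size_valley_word nth_valley_word /is_peak /f => iw.
by do ![case: eqVneq => ? /=]; lia.
Qed.

Lemma word_prob_peak_ge : 3^-1 <= word_prob R peak_word.
Proof.
rewrite /word_prob /perm_prob (_ : (size peak_word)`! = 6%N) //.
suff : (2 <= perm_count 3 (fits peak_word))%N.
  rewrite -(ler_nat R) => h; rewrite ler_pdivlMr ?ltr0n //; lra.
pose o0 : 'I_3 := @Ordinal 3 0 isT; pose o1 : 'I_3 := @Ordinal 3 1 isT.
pose o2 : 'I_3 := @Ordinal 3 2 isT.
(* In one-line notation these are 132 and 231, which gives 2 of the 6 permutations. *)
pose s := tperm o1 o2; pose t := (tperm o1 o2 * tperm o0 o1)%g.
have val0 (u : 'S_3) : perm_val 3 u 0 = u o0 by rewrite -perm_valE.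
have val1 (u : 'S_3) : perm_val 3 u 1 = u o1 by rewrite -perm_valE.
have val2 (u : 'S_3) : perm_val 3 u 2 = u o2 by rewrite -perm_valE.
have s0 : s o0 = o0 by rewrite tpermD.
have s1 : s o1 = o2 by rewrite tpermL.
have s2 : s o2 = o1 by rewrite tpermR.
have t0 : t o0 = o1 by rewrite permM s0 tpermL.
have t1 : t o1 = o2 by rewrite permM s1 tpermD.
have t2 : t o2 = o0 by rewrite permM s2 tpermR.
have ne : s != t by apply/eqP => /permP/(_ o0); rewrite s0 t0.
apply: (@leq_trans #|[set s; t]%SET|); first by rewrite cards2 ne.
apply/subset_leq_card/fintype.subsetP => u; rewrite !inE /fits /is_peak /=.
rewrite val0 val1 val2 => /orP[] /eqP ->.
  by rewrite s0 s1 s2.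
by rewrite t0 t1 t2.
Qed.

End Words.

(** * Periodic sets and prefixes of periodic words *)

Definition periodic_prefix (x : seq bool) (n : nat) : seq bool :=
  mkseq (fun i => nth false x (i %% size x)) n.

Definition periodic_peaks (x : seq bool) : set nat :=
  [set i | (0 < i)%N && nth false x (i.-1 %% size x)].

Lemma periodic_set_peaks (x : seq bool) : x <> [::] -> periodic_set (periodic_peaks x).
Proof.
by move=> x0; exists x => // i; apply/idP/idP; rewrite inE /periodic_peaks /= ?inE.
Qed.

(** Peak positions are counted from 1 and sequence indices from 0, hence the predecessor. *)
Lemma has_peakE (n : nat) (s : 'S_n) (i : nat) :
  has_peak s i <-> (1 < i < n)%N && is_peak (perm_val n s) i.-1.
Proof.
split=> [[a [b [c [ai bi ci sab scb]]]]|].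
  rewrite -bi /=; have := ltn_ord a; have := ltn_ord c.
  rewrite /is_peak (_ : b.-1 = a)%N; last lia.
  rewrite (_ : b.+1 = c)%N; last lia.
  by rewrite !perm_valE sab scb; lia.
case: i => [|[|i]] //= /andP[lin /andP[]].
have hi : (i < n)%N by lia.
have hi1 : (i.+1 < n)%N by lia.
rewrite /perm_val /= !ext_ordE => h1 h2.
by exists (Ordinal hi), (Ordinal hi1), (Ordinal lin).
Qed.

(** Position 1 is never a peak, yet the peak set must match the given set there too. A first letter
    0 reconciles this with [fits], which tests interior letters only. *)
Lemma peak_count_periodic (x : seq bool) (n : nat) : ~~ nth false x 0 ->
  peak_count n (periodic_peaks x) = perm_count n (fits (periodic_prefix x n)).
Proof.
move=> x0; apply: eq_card => s; rewrite !inE.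
apply/asboolP/fitsP; rewrite size_mkseq => H.
  move=> i i0 lti; rewrite nth_mkseq; last lia.
  have : has_peak s i.+1 <-> periodic_peaks x i.+1 /\ (1 <= i.+1 <= n.-1)%N.
    by have := congr1 (fun A : set nat => A i.+1) H; rewrite /peak_set /= => ->.
  rewrite has_peakE /periodic_peaks /=; move=> [h1 h2]; apply/idP/idP => h.
    by case: h1 => //; rewrite h; lia.
  by move: h2; rewrite h => /(_ ltac:(lia)) /andP[].
apply/seteqP; split => i; rewrite /peak_set /= has_peakE /periodic_peaks /=.
  case: i => [|[|i]] //= /andP[lti]; rewrite H // nth_mkseq; last lia.
  by move=> ->; split => //; lia.
case: i => [|[|i]] /=; first by case.
  by rewrite mod0n (negPf x0) => -[].
move=> [h ltin]; rewrite H ?nth_mkseq ?h; lia.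
Qed.

Lemma size_periodic_prefix (x : seq bool) (n : nat) : size (periodic_prefix x n) = n.
Proof. exact: size_mkseq. Qed.

Lemma periodic_prefixD (x : seq bool) (m n : nat) : (size x %| m)%N ->
  periodic_prefix x (m + n) = periodic_prefix x m ++ periodic_prefix x n.
Proof.
move=> dvdxm; apply: (@eq_from_nth _ false).
  by rewrite size_cat !size_periodic_prefix.
move=> i; rewrite size_periodic_prefix => lti.
rewrite nth_mkseq // nth_cat size_periodic_prefix.
case: ltnP => him; first by rewrite nth_mkseq.
by rewrite nth_mkseq ?ltn_subLR // -[in LHS](subnKC him) -modnDml (eqP dvdxm) add0n.
Qed.

Lemma periodic_prefix_size (x : seq bool) : periodic_prefix x (size x) = x.
Proof.
apply: (@eq_from_nth _ false); first by rewrite size_periodic_prefix.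
by move=> i; rewrite size_periodic_prefix => lti; rewrite nth_mkseq // modn_small.
Qed.

Lemma periodic_prefixM (x : seq bool) (q : nat) :
  periodic_prefix x (q * size x) = flatten (nseq q x).
Proof.
elim: q => [|q IHq] //=; rewrite mulSn periodic_prefixD ?dvdnn //.
by rewrite periodic_prefix_size IHq.
Qed.

(** * Growth rate of a periodic set with sealed period *)

Section Growth.
Variable R : realType.

Lemma word_prob_prefix_le (x : seq bool) (m n : nat) : (m <= n)%N ->
  word_prob R (periodic_prefix x n) <= word_prob R (periodic_prefix x m).
Proof.
move=> /subnKC <-; elim: (n - m)%N => [|k IHk]; first by rewrite addn0.
apply: le_trans IHk; rewrite addnS /periodic_prefix /mkseq -addn1 iotaD map_cat.
exact: word_prob_catl_le.
Qed.

Lemma cvg_powR_harmonic (Q e c : R) : 0 < Q ->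
  Q `^ (e + c * (n%:R)^-1) @[n --> \oo] --> Q `^ e.
Proof.
move=> Q0; rewrite /powR gt_eqF //.
apply: continuous_cvg; first exact: continuous_expR.
apply: cvgM; last exact: cvg_cst.
rewrite -[X in _ --> X]addr0; apply: cvgD; first exact: cvg_cst.
rewrite -[X in _ --> X](mulr0 c); apply: cvgM; first exact: cvg_cst.
(* [harmonic] has terms 1/(n+1), hence the shift. *)
by rewrite -cvg_shiftS; exact: cvg_harmonic.
Qed.

(** A prefix of length n lies between q and q+1 copies of x, where q is the quotient of n by |x|.
    Its probability is therefore between Q^(q+1) and Q^q, and both (q+1)/n and q/n are close enough
    to 1/|x| for a squeeze with error 1/n in the exponent. *)
Lemma growth_periodic (x : seq bool) : sealed x -> x <> [::] -> 0 < word_prob R x ->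
  growth_seq R (periodic_peaks x) @ \oo --> word_prob R x `^ (size x)%:R^-1.
Proof.
move=> sx x0 Q0.
have xpos : (0 < size x)%N by case: (x) x0.
have N0 : 0 < (size x)%:R :> R by rewrite ltr0n.
have hd : ~~ nth false x 0.
  by case/orP: sx => [/eqP -> //|/and5P[]].
set Q := word_prob R x.
have Q1 : Q <= 1 by apply: word_prob_le1.
have aE n : growth_seq R (periodic_peaks x) n =
    word_prob R (periodic_prefix x n) `^ (n%:R)^-1.
  by rewrite /growth_seq peak_count_periodic // /word_prob size_periodic_prefix.
have aM q : word_prob R (periodic_prefix x (q * size x)) = Q ^+ q.
  by rewrite periodic_prefixM word_prob_flatten_nseq.
pose N : R := (size x)%:R.
apply: (@squeeze_cvgr _ _ _ _ (fun n => Q `^ (N^-1 + (n%:R)^-1)) (fun n => Q `^ (N^-1 - (n%:R)^-1))).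
- near=> n; rewrite aE.
  have n0 : (0 < n)%N by near: n; exists 1%N.
  have nR0 : 0 < n%:R :> R by rewrite ltr0n.
  set q := (n %/ size x)%N.
  have lo : (q * size x <= n)%N by apply: leq_trunc_div.
  have hi : (n < q.+1 * size x)%N by apply: ltn_ceil.
  have loR : q%:R * N <= n%:R by rewrite -natrM ler_nat.
  have hiR : n%:R <= (q%:R + 1) * N by rewrite natr1 -natrM ler_nat ltnW.
  have ninv : 0 <= (n%:R)^-1 :> R by rewrite invr_ge0 ltW.
  have QE k : (Q ^+ k) `^ (n%:R)^-1 = Q `^ (k%:R / n%:R).
    by rewrite powRrM powR_mulrn // ltW.
  apply/andP; split.
    apply: (@le_trans _ _ ((Q ^+ q.+1) `^ (n%:R)^-1)); last first.
      apply: ge0_ler_powR => //; rewrite ?nnegrE ?exprn_ge0 ?word_prob_ge0 //.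
      by rewrite -aM; apply: word_prob_prefix_le; apply: ltnW.
    (* As 0 < Q <= 1, the power decreases in its exponent; it remains to check (q+1)/n <= 1/|x| +
       1/n. *)
    rewrite QE; apply: ger_powR; first by rewrite Q0.
    rewrite -natr1 ler_pdivrMr // mulrDl mulVf ?gt_eqF // lerD2r.
    by rewrite mulrC ler_pdivlMr.
  apply: (@le_trans _ _ ((Q ^+ q) `^ (n%:R)^-1)).
    apply: ge0_ler_powR => //; rewrite ?nnegrE ?exprn_ge0 ?word_prob_ge0 //.
    by rewrite -aM; apply: word_prob_prefix_le.
  rewrite QE; apply: ger_powR; first by rewrite Q0.
  rewrite ler_pdivlMr // mulrBl mulVf ?gt_eqF // lerBlDr.
  by rewrite mulrC ler_pdivrMr.
- by under eq_fun do rewrite -[(_%:R)^-1]mul1r; exact: cvg_powR_harmonic.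
- by under eq_fun do rewrite -mulN1r; exact: cvg_powR_harmonic.
Unshelve. all: by end_near.
Qed.

End Growth.

(** * Density of weighted geometric means, and arbitrarily small rates *)

Section GeometricMeans.
Variable R : realType.

Lemma exprK_powR (y : R) (n : nat) : (0 < n)%N -> 0 <= y -> (y ^+ n) `^ (n%:R)^-1 = y.
Proof.
move=> n0 y0; rewrite -powR_mulrn // -powRrM mulfV ?powRr1 //.
by rewrite pnatr_eq0 -lt0n.
Qed.

Lemma powRK_expr (y : R) (n : nat) : (0 < n)%N -> 0 <= y -> (y `^ (n%:R)^-1) ^+ n = y.
Proof.
move=> n0 y0; rewrite -powR_mulrn ?powR_ge0 // -powRrM mulVf ?powRr1 //.
by rewrite pnatr_eq0 -lt0n.
Qed.

Lemma bernoulli_le (x : R) (n : nat) : 0 <= x -> 1 + n%:R * x <= (1 + x) ^+ n.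
Proof.
move=> x0; elim: n => [|n IHn]; first by rewrite mul0r addr0 expr0.
rewrite exprS; apply: (@le_trans _ _ ((1 + x) * (1 + n%:R * x))); last first.
  by apply: ler_wpM2l => //; apply: addr_ge0.
rewrite -natr1; have : 0 <= n%:R * x * x by rewrite !mulr_ge0 ?ler0n.
lra.
Qed.

(** The points b r^i with r = (a/b)^(1/t) climb from b to a. The first one to reach L exceeds it by
    less than eps: its predecessor is below L <= 1, and r <= 1 + eps. *)
Lemma geometric_approx (a b L eps : R) : 0 < b -> b <= L <= a -> L <= 1 -> 0 < eps ->
  exists t i : nat, [/\ (0 < t)%N, (i <= t)%N &
    `|b * ((a / b) `^ (t%:R)^-1) ^+ i - L| < eps].
Proof.
move=> b0 /andP[bL La] L1 e0.
have ab0 : 0 < a / b by rewrite divr_gt0 //; lra.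
(* Chosen so that r^t = a/b <= 1 + t eps <= (1 + eps)^t, by Bernoulli. *)
pose t := (Num.bound (a / b / eps)).+1.
have tR : a / b <= 1 + t%:R * eps.
  have abe0 : 0 <= a / b / eps by rewrite ltW // divr_gt0.
  have := archi_boundP abe0; rewrite ltr_pdivrMr //.
  by rewrite /t -natr1; lra.
pose r := (a / b) `^ (t%:R)^-1.
have r0 : 0 <= r by apply: powR_ge0.
have rt : r ^+ t = a / b by apply: powRK_expr => //; apply: ltW.
have r1 : r <= 1 + eps.
  rewrite -(@ler_pXn2r _ t) ?nnegrE //; last by lra.
  by rewrite rt; apply: le_trans tR _; apply: bernoulli_le; apply: ltW.
have ex : exists i, L <= b * r ^+ i.
  by exists t; rewrite rt mulrC divfK // gt_eqF.
have [i Li imin] := ex_minnP ex.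
exists t, i; split => //.
  by apply: imin; rewrite rt mulrC divfK // gt_eqF.
rewrite -/r ger0_norm ?subr_ge0 //.
case: i Li imin => [|i] Li imin.
  by rewrite expr0 mulr1 in Li *; lra.
have lt : b * r ^+ i < L.
  by rewrite ltNge; apply/negP => /imin; rewrite ltnn.
rewrite exprSr mulrA.
have : b * r ^+ i * r < L + eps; last lra.
have g0 : 0 <= b * r ^+ i by rewrite mulr_ge0 ?exprn_ge0 // ltW.
have h1 : b * r ^+ i * r <= b * r ^+ i * (1 + eps) by apply: ler_wpM2l.
apply: le_lt_trans h1 _.
have : b * r ^+ i * (1 + eps) < L * (1 + eps) by rewrite ltr_pM2r //; lra.
have : L * eps <= 1 * eps by rewrite ler_pM2r.
lra.
Qed.

(** It suffices that 2/h! < eps^(2h+4), that is (eps^-2)^h / h! < eps^4 / 2. The left side is a term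
    of the exponential series and tends to 0. *)
Lemma valley_growth_small (eps : R) : 0 < eps -> exists2 h : nat, (0 < h)%N &
  word_prob R (valley_word h) `^ (size (valley_word h))%:R^-1 < eps.
Proof.
move=> e0; have e4 : 0 < eps ^+ 4 / 2 by rewrite divr_gt0 ?exprn_gt0.
have /cvgr0Pnorm_lt /(_ _ e4) [n _ small] := cvg_exp_coeff ((eps ^+ 2)^-1).
exists n.+1 => //; rewrite size_valley_word.
have := small n.+1 (leqnSn n); move: (n.+1) => h {n small}.
rewrite /exp_coeff /= ger0_norm; last first.
  by rewrite divr_ge0 ?exprn_ge0 ?invr_ge0 ?exprn_ge0 ?ler0n // ltW.
set k := (h + h + 4)%N => small.
have k0 : (0 < k)%N by rewrite /k addnS.
rewrite -[X in _ < X](exprK_powR _ _ k0 (ltW e0)).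
apply: gt0_ltr_powR; rewrite ?nnegrE ?word_prob_ge0 ?exprn_ge0 ?invr_gt0 ?ltr0n // ?ltW //.
apply: le_lt_trans (word_prob_valley_le _ _) _.
have eh : 0 < eps ^+ (h + h) by apply: exprn_gt0.
rewrite exprVn -exprM mul2n -addnn in small.
have := small; rewrite -(ltr_pM2l eh) mulrA mulfV ?gt_eqF // mul1r.
rewrite /k [_ ^+ (_ + 4)]exprD; lra.
Qed.

End GeometricMeans.

(** * Mixing the two words into one period *)

Theorem theorem1p4 (R : realType) (L eps : R)
    (hL : 0 <= L <= 1 / (3 `^ (3^-1))) (heps : 0 < eps) :
  exists I : set nat,
    [/\ I `<=` [set i | (0 < i)%N],
        periodic_set I,
        cvgn (growth_seq R I) &
        `| limn (growth_seq R I) - L | < eps].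
Proof.
suff [x [sx x0 Q0 close]] : exists x : seq bool, [/\ sealed x, x <> [::],
    0 < word_prob R x & `|word_prob R x `^ (size x)%:R^-1 - L| < eps].
  exists (periodic_peaks x); have lim := growth_periodic R x sx x0 Q0.
  split; first by move=> i /andP[].
  - exact: periodic_set_peaks.
  - by apply/cvg_ex; eexists; exact: lim.
  - by rewrite (cvg_lim _ lim).
have [h h0 small] := valley_growth_small R eps heps.
have B0 := word_prob_valley_gt0 R h h0.
set B := valley_word h in small B0; set k := size B in small.
have k0 : (0 < k)%N by rewrite /k size_valley_word addnS.
set b := word_prob R B `^ _ in small.
have b0 : 0 < b by apply: powR_gt0.
(* If 0 <= L <= b < eps, the valley word alone is a suitable period. *)
have [Lb|bL] := leP L b.
  exists B; split => //; first exact: sealed_valley_word.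
  by rewrite -/k -/b; move: hL => /andP[L0 _]; rewrite ger0_norm; lra.
have A3 := word_prob_peak_ge R.
have A0 : 0 < word_prob R peak_word by apply: lt_le_trans A3; rewrite invr_gt0.
pose a := word_prob R peak_word `^ (3%:R)^-1.
have a0 : 0 < a by apply: powR_gt0.
have La : L <= a.
  case/andP: hL => _ /le_trans; apply.
  (* The bound 1/3^(1/3) is rewritten as (1/3)^(1/3), to be compared with the probability of 010,
     which is at least 1/3. *)
  rewrite div1r -powR_inv1 ?powR_ge0 // -powRrM mulrC powRrM powR_inv1 //.
  by apply: ge0_ler_powR; rewrite ?nnegrE ?invr_ge0 // ltW.
have a1 : a <= 1.
  rewrite (_ : 1 = 1 `^ (3%:R)^-1); last by rewrite powR1.
  by apply: ge0_ler_powR; rewrite ?nnegrE ?word_prob_ge0 ?word_prob_le1.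
have bLa : b <= L <= a by rewrite La ltW.
have [t [i [t0 it close]]] := geometric_approx R a b L eps b0 bLa (le_trans La a1) heps.
pose r := (a / b) `^ (t%:R)^-1.
have rt : r ^+ t = a / b by apply: powRK_expr => //; rewrite ltW ?divr_gt0.
(* The multiplicities compensate for the lengths 3 and k: the two parts have 3ik and 3(t-i)k
   letters, so the rate of x is a^(i/t) b^((t-i)/t) = b r^i. *)
pose x := flatten (nseq (i * k) peak_word) ++ flatten (nseq ((t - i) * 3) B).
have sB := sealed_valley_word h.
have size_x : size x = (t * (3 * k))%N.
  rewrite /x size_cat !size_flatten /shape !map_nseq !sumn_nseq -/k /=.
  by rewrite -[in RHS](subnKC it); ring.
have Qx : word_prob R x = (b * r ^+ i) ^+ (t * (3 * k)).
  rewrite /x word_prob_sealed_cat ?sealed_flatten_nseq ?sealed_peak_word //.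
  rewrite !word_prob_flatten_nseq ?sealed_peak_word //.
  have -> : word_prob R peak_word = a ^+ 3 by rewrite powRK_expr // ltW.
  have -> : word_prob R B = b ^+ k by rewrite powRK_expr // ltW.
  (* Everything becomes a product of powers of b and r, and only the exponents are left to
     compare. *)
  have -> : a = b * r ^+ t by rewrite rt mulrC divfK // gt_eqF.
  rewrite -!exprM !exprMn -!exprM.
  rewrite [LHS]mulrAC -exprD; congr (_ ^+ _ * _ ^+ _).
    by rewrite -[in RHS](subnKC it); ring.
  by ring.
exists x; split.
- by apply: sealed_cat; apply: sealed_flatten_nseq.
- move=> x_nil; have : (0 < size x)%N by rewrite size_x !muln_gt0 t0 k0.
  by rewrite x_nil.
- by rewrite Qx exprn_gt0 // mulr_gt0 // exprn_gt0 // powR_gt0 // divr_gt0.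
- rewrite Qx size_x exprK_powR ?muln_gt0 ?t0 //.
  by rewrite mulr_ge0 ?exprn_ge0 ?powR_ge0 // ltW.
Qed.
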